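(* Let $n \ge 2$, let $K$ be a (non-archimedean) local field, and let $Y_n$ be the graph of special vertices of the affine building $\Delta_n$ of $\mathrm{Sp}_n(K)$. Then the isoperimetric constant of $Y_n$ satisfies $h(Y_n)>0$.
   Context: $K$ is a local field with discrete valuation $\mathrm{ord}$, valuation ring $\mathcal{O}$, uniformizer $\pi$, residue field $k\cong\mathbb{F}_q$. $V$ is a $2n$-dimensional $K$-vector space with a non-degenerate alternating bilinear form $\langle\cdot,\cdot\rangle$. A lattice in $V$ is a free rank-$2n$ $\mathcal{O}$-submodule of $V$; lattices $L,L'$ are homothetic if $L'=\alpha L$ for some $\alpha\in K^\times$, and $[L]$ is the homothety class of $L$. A lattice $L$ is primitive if $\langle L,L\rangle\subseteq\mathcal{O}$ and $\langle\cdot,\cdot\rangle$ induces a non-degenerate alternating $k$-bilinear form on $L/\pi L$. The building $\Delta_n$: a vertex of $\Delta_n$ is a homothety class of lattices having a representative $L$ for which there is a primitive lattice $L_0$ with $\langle L,L\rangle\subseteq\pi\mathcal{O}$ and $\pi L_0\subseteq L\subseteq L_0$. Two vertices $t,t'$ are incident if there are representatives $L\in t$, $L'\in t'$ and a primitive lattice $L_0$ with $\langle L,L\rangle\subseteq\pi\mathcal{O}$, $\langle L',L'\rangle\subseteq\pi\mathcal{O}$, and either $\pi L_0\subseteq L\subseteq L'\subseteq L_0$ or $\pi L_0\subseteq L'\subseteq L\subseteq L_0$. Two distinct incident vertices are called adjacent. A basis $\{u_1,\dots,u_n,w_1,\dots,w_n\}$ of $V$ is symplectic if $\langle u_i,w_j\rangle=\delta_{ij}$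 and $\langle u_i,u_j\rangle=0=\langle w_i,w_j\rangle$ for all $i,j$. A vertex $[L]$ of $\Delta_n$ is special if, writing $L=\sum_i\mathcal{O}\pi^{a_i}u_i+\sum_i\mathcal{O}\pi^{b_i}w_i$ in a symplectic basis (with $a_i,b_i\in\mathbb{Z}$), the sum $a_i+b_i$ is the same for all $i$ (this does not depend on the choices). $Y_n$ is the graph whose vertices are the special vertices of $\Delta_n$, two of them being joined by an edge iff they are adjacent in $\Delta_n$. For a connected graph $X$ with infinitely many vertices, regular of finite degree, and a set $X'$ of vertices, $\partial X'$ is the set of edges of $X$ incident to exactly one vertex of $X'$; the isoperimetric constant is $h(X)=\inf\big(\mathrm{Card}(\partial X')/\mathrm{Card}(X')\big)$ over all finite non-empty sets $X'$ of vertices of $X$. *)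

(* Defs.v *)
From HB Require Import structures.
From mathcomp Require Import all_boot all_order all_algebra sesquilinear finmap.
From mathcomp Require Import boolp classical_sets cardinality reals.

Set Implicit Arguments.
Unset Strict Implicit.
Unset Printing Implicit Defensive.

Import Order.TTheory GRing.Theory Num.Theory.
Local Open Scope classical_set_scope.
Local Open Scope ring_scope.

Section LocalField.
Variables (K : fieldType) (ord : K -> int).

(* The value of [ord] at 0 is irrelevant: 0 is treated as having infinite
   valuation. *)
Definition ord_ge (N : int) (x : K) : Prop := x = 0 \/ N <= ord x.

Definition valuation_ring : set K := [set x | ord_ge 0 x].

Definition maximal_ideal : set K := [set x | ord_ge 1 x].

(* The underlying set of the residue field, as a set of cosets. *)
Definition residue_field : set (set K) :=
  [set [set x + m | m in maximal_ideal] | x in valuation_ring].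

Definition ord_cauchy (u : nat -> K) : Prop :=
  forall N : int, exists m : nat,
    forall i j : nat, (m <= i)%N -> (m <= j)%N -> ord_ge N (u i - u j).

Definition ord_converges (u : nat -> K) (l : K) : Prop :=
  forall N : int, exists m : nat,
    forall i : nat, (m <= i)%N -> ord_ge N (u i - l).

Record local_field : Prop := LocalField {
  ord_mul : forall x y, x != 0 -> y != 0 -> ord (x * y) = ord x + ord y;
  ord_add : forall x y, x != 0 -> y != 0 -> x + y != 0 ->
    Order.min (ord x) (ord y) <= ord (x + y);
  ord_normalized : exists2 x, x != 0 & ord x = 1;
  ord_complete : forall u, ord_cauchy u -> exists l, ord_converges u l;
  residue_finite : finite_set residue_field
}.

Definition uniformizer (pi : K) : Prop := pi != 0 /\ ord pi = 1.

End LocalField.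

Section Form.
Variables (K : fieldType) (V : vectType K).

Definition alternating_form (B : {biscalar V}) : Prop := forall x, B x x = 0.

Definition nondegenerate_form (B : {biscalar V}) : Prop :=
  forall x, (forall y, B x y = 0) -> x = 0.

Definition symplectic_basis (B : {biscalar V}) (n : nat) (u w : n.-tuple V) :
    Prop :=
  [/\ basis_of fullv (u ++ w),
      forall i j, B (tnth u i) (tnth w j) = (i == j)%:R,
      forall i j, B (tnth u i) (tnth u j) = 0
    & forall i j, B (tnth w i) (tnth w j) = 0].

End Form.

Section Building.
Variables (K : fieldType) (ord : K -> int) (pi : K).
Variables (n : nat) (V : vectType K) (B : {biscalar V}).

Local Notation O := (valuation_ring ord).

Definition pi_ideal : set K := [set pi * x | x in O].

Definition dilate (a : K) (L : set V) : set V := [set a *: x | x in L].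

Definition lattice (L : set V) : Prop :=
  exists e : (2 * n).-tuple V,
    (forall c : 'I_(2 * n) -> K, (forall i, O (c i)) ->
       \sum_i c i *: tnth e i = 0 -> forall i, c i = 0) /\
    L = [set x | exists c : 'I_(2 * n) -> K,
          (forall i, O (c i)) /\ x = \sum_i c i *: tnth e i].

Definition homothety_class (L : set V) : set (set V) :=
  [set L' | exists2 a : K, a != 0 & L' = dilate a L].

Definition form_in (L : set V) (S : set K) : Prop :=
  forall x y, L x -> L y -> S (B x y).

(* The last clause is the non-degeneracy of the form induced on L / pi L; that
   this form is well defined, k-bilinear and alternating follows from the other
   clauses. *)
Definition primitive (L : set V) : Prop :=
  [/\ lattice L, form_in L O
    & forall x, L x -> (forall y, L y -> pi_ideal (B x y)) -> dilate pi L x].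

Definition building_vertex (t : set (set V)) : Prop :=
  exists L L0 : set V,
    [/\ lattice L /\ t = homothety_class L, primitive L0,
        form_in L pi_ideal, dilate pi L0 `<=` L & L `<=` L0].

Definition incident (t t' : set (set V)) : Prop :=
  exists L L' L0 : set V,
    [/\ t L /\ t' L', primitive L0,
        form_in L pi_ideal, form_in L' pi_ideal
      & [/\ dilate pi L0 `<=` L, L `<=` L' & L' `<=` L0] \/
        [/\ dilate pi L0 `<=` L', L' `<=` L & L `<=` L0]].

Definition adjacent (t t' : set (set V)) : Prop :=
  [/\ building_vertex t, building_vertex t', t <> t' & incident t t'].

Definition lattice_of (u w : n.-tuple V) (a b : 'I_n -> int) : set V :=
  [set x | exists c d : 'I_n -> K,
    [/\ forall i, O (c i), forall i, O (d i)
      & x = \sum_i (c i * pi ^ a i) *: tnth u i +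
            \sum_i (d i * pi ^ b i) *: tnth w i]].

Definition special_vertex (t : set (set V)) : Prop :=
  building_vertex t /\
  exists (u w : n.-tuple V) (a b : 'I_n -> int),
    [/\ symplectic_basis B u w, t (lattice_of u w a b)
      & exists s : int, forall i, a i + b i = s].

End Building.

Record graph (T : Type) := Graph {
  vertices : set T;
  adj : T -> T -> Prop
}.

Definition edges (T : Type) (X : graph T) : set (set T) :=
  [set e | exists x y : T,
     [/\ vertices X x, vertices X y, adj X x y & e = [set x; y]]].

Definition edge_boundary (T : Type) (X : graph T) (A : set T) : set (set T) :=
  [set e | edges X e /\ exists! x, A x /\ e x].

(* [fset_set] sends infinite sets to the empty set, so a finite [A] with an
   infinite boundary contributes the ratio 0: positivity of the constant
   forces all boundaries of finite non-empty sets to be finite and non-empty. *)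
Definition isoperimetric_constant (R : realType) (T : choiceType)
    (X : graph T) : R :=
  inf [set r | exists A : set T,
    [/\ A `<=` vertices X, finite_set A, A !=set0
      & r = #|` fset_set (edge_boundary X A)|%:R / #|` fset_set A|%:R]].

Definition special_graph (K : fieldType) (ord : K -> int) (pi : K) (n : nat)
    (V : vectType K) (B : {biscalar V}) : graph (set (set V)) :=
  {| vertices := [set t | special_vertex ord pi n B t];
     adj := adjacent ord pi n B |}.

(* Main.v *)
Require Import Defs.
From HB Require Import structures.
From mathcomp Require Import all_boot all_order all_algebra sesquilinear finmap.
From mathcomp Require Import boolp classical_sets cardinality reals.
From mathcomp Require Import zify.

Set Implicit Arguments.
Unset Strict Implicit.
Unset Printing Implicit Defensive.

Import Order.TTheory GRing.Theory Num.Theory.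
Local Open Scope classical_set_scope.
Local Open Scope ring_scope.

(** Fix a non-zero vector [v] of V. If [L] is a lattice whose dual is
    pi^(-s) L and [m] is minimal with pi^m v in [L], then the integer 2m - s is
    unchanged when [L] is multiplied by a scalar, so it defines a height on the
    special vertices; it plays the role of a Busemann function for the point at
    infinity given by the line Kv.

    An edge of Y_n joins [L], with dual pi^(-s) L, to [M], with dual
    pi^(-s-1) M and pi L <= M <= L ([adjacent_linked]); that is, M / pi L is a
    Lagrangian subspace of L / pi L. Put e = pi^m v. If M contains [e] then the
    height drops by one from [L] to [M], and otherwise it rises by one. So the
    neighbours of a vertex one step up are the Lagrangians that avoid the line
    of [e], those one step down are the Lagrangians that contain it, and there
    are strictly more of the former ([card_down_lt_up]). No exact count is
    needed: choose f in L with <e,f> = pi^s; two products of transvections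
    preserve L and send [e] to e + f and to f ([two_fixing_isometries]). Since
    <e + f, e> and <f, e> are units times pi^s, they map the Lagrangians
    containing [e] to Lagrangians avoiding it; since <e + f, f> is such a unit
    as well, the two images are disjoint. Hence there are at least twice as many
    neighbours above as below, and there is at least one neighbour
    ([special_has_neighbour]).

    Now let A be a finite set of vertices. The upward edges that start in A
    number at least |A| more than those that end in A; the edges inside A
    are counted on both sides, so at least |A| upward edges leave A
    ([leq_card_edge_boundary]). All vertices have finitely many neighbours, as
    L / pi L is finite, and special vertices exist, as V has a symplectic
    basis; thus the isoperimetric constant is at least 1. *)

(** * Expansion from an orientation with more outgoing than incoming edges *)

Section Expansion.
Variables (T : choiceType) (X : graph T) (up : T -> T -> Prop).

Definition neighbours (x : T) : set T :=
  [set y | vertices X y /\ (adj X x y \/ adj X y x)].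

Local Notation out x := (fset_set [set y | up x y]).
Local Notation into x := (fset_set [set y | up y x]).

Hypothesis up_edge : forall x y, up x y ->
  [/\ vertices X x, vertices X y & adj X x y].
Hypothesis finite_neighbours :
  forall x, vertices X x -> finite_set (neighbours x).

Lemma finite_edge_boundary (A : set T) :
  A `<=` vertices X -> finite_set A -> finite_set (edge_boundary X A).
Proof.
move=> sAX finA.
apply: (@sub_finite_set _ _
  (\bigcup_(x in A) [set [set x; y] | y in neighbours x])).
  move=> e [[x [y [Xx Xy xy ->]]] [z [[Az ez] _]]]; case: ez Az => -> Az.
  - by exists x => //; exists y => //; split=> //; left.
  - by exists y => //; exists x; [split=> //; right | rewrite setUC].
apply: bigcup_finite => // x Ax; apply: finite_image.
exact/finite_neighbours/sAX.
Qed.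

Let finite_out x : vertices X x -> finite_set [set y | up x y].
Proof.
move=> Xx; apply: sub_finite_set (finite_neighbours Xx) => y /up_edge[_ Xy xy].
by split=> //; left.
Qed.

Let finite_into x : vertices X x -> finite_set [set y | up y x].
Proof.
move=> Xx; apply: sub_finite_set (finite_neighbours Xx) => y /up_edge[Xy _ yx].
by split=> //; right.
Qed.

(** Writing the number of common elements as a sum of indicators lets the edges
    inside a set be counted from either end by exchanging two sums. *)
Lemma card_fsetI_sum (A C : {fset T}) :
  #|` C `&` A|%fset = (\sum_(y <- A) (y \in C))%N.
Proof.
have /perm_size -> : perm_eq (C `&` A)%fset [seq y <- A | y \in C].
  apply: uniq_perm; [exact: fset_uniq | exact/filter_uniq/fset_uniq |].
  by move=> y; rewrite mem_filter in_fsetI.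
by rewrite size_filter -sum1_count big_mkcond /=; apply: eq_bigr => y _; case: in_mem.
Qed.

(** An edge leaving [A] is recovered from its two ends, and its origin is the
    end lying in [A]; so distinct pairs (origin, target) give distinct edges. *)
Lemma leaving_edges_leq (A : set T) :
  A `<=` vertices X -> finite_set A ->
  (\sum_(x <- fset_set A) #|` out x `\` fset_set A|%fset
     <= #|` fset_set (edge_boundary X A)|)%N.
Proof.
move=> sAX finA; set F := fset_set A.
have inF x : (x \in F) = (x \in A) by rewrite /F in_fset_set.
have leaving x y : x \in F -> y \in (out x `\` F)%fset ->
    [/\ A x, ~ A y & up x y].
  rewrite inF => /set_mem Ax; rewrite in_fsetD inF => /andP[/negP Ay].
  rewrite in_fset_set; last exact/finite_out/sAX.
  by move/set_mem => u; split=> // Ay'; apply/Ay/mem_set.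
pose s := [seq [set x; y] | x <- F, y <- (out x `\` F)%fset].
have -> : (\sum_(x <- F) #|` out x `\` F|%fset)%N = size s.
  by rewrite size_allpairs_dep sumnE big_map.
apply: uniq_leq_size.
  apply: allpairs_uniq_dep => [|x _|]; try exact: fset_uniq.
  move=> _ _ /allpairsPdep[x [y [Fx xy ->]]] /allpairsPdep[x' [y' [Fx' xy' ->]]] /=.
  have [Ax nAy _] := leaving _ _ Fx xy; have [Ax' nAy' _] := leaving _ _ Fx' xy'.
  move=> eqe.
  have ex : x = x'.
    have : [set x; y] x by left.
    by rewrite eqe => -[] // xy'E; case: nAy'; rewrite -xy'E.
  have ey : y = y'.
    have : [set x; y] y by right.
    by rewrite eqe => -[] // yx'E; case: nAy; rewrite yx'E.
  by rewrite ex ey.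
move=> _ /allpairsPdep[x [y [Fx xy ->]]].
have [Ax nAy u] := leaving _ _ Fx xy; have [Xx Xy axy] := up_edge u.
rewrite in_fset_set; last exact: finite_edge_boundary.
apply/mem_set; split; first by exists x, y.
by exists x; split=> [|z [Az [-> //|zy]]]; [split=> //; left | case: nAy; rewrite -zy].
Qed.

(** Arrows inside [A] have both ends in [A], so the sum over [A] of
    (outgoing - incoming) is at most the number of arrows leaving [A]. *)
Lemma leq_card_edge_boundary (A : set T) :
  (forall x, vertices X x -> (#|` into x| < #|` out x|)%N) ->
  A `<=` vertices X -> finite_set A ->
  (#|` fset_set A| <= #|` fset_set (edge_boundary X A)|)%N.
Proof.
move=> expand sAX finA; apply: leq_trans (leaving_edges_leq sAX finA).
set F := fset_set A.
have FX x : x \in F -> vertices X x.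
  by rewrite /F in_fset_set // => /set_mem /sAX.
have inner : (\sum_(x <- F) #|` out x `&` F|%fset =
              \sum_(x <- F) #|` into x `&` F|%fset)%N.
  under eq_bigr do rewrite card_fsetI_sum.
  rewrite exchange_big /=; apply: eq_big_seq => y Fy; rewrite card_fsetI_sum.
  apply: eq_big_seq => x Fx.
  by rewrite !in_fset_set; [by [] | exact/finite_into/FX | exact/finite_out/FX].
have split_out : (\sum_(x <- F) #|` out x| =
    \sum_(x <- F) #|` out x `&` F|%fset + \sum_(x <- F) #|` out x `\` F|%fset)%N.
  by rewrite -big_split; apply: eq_bigr => x _ /=; rewrite cardfsID.
rewrite -(leq_add2l (\sum_(x <- F) #|` into x|)%N).
apply: (@leq_trans (\sum_(x <- F) #|` out x|)%N).
  rewrite card_fset_sum1 -big_split /=.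
  rewrite big_seq_cond [leqRHS]big_seq_cond; apply: leq_sum => x /andP[Fx _].
  by rewrite addn1; apply/expand/FX.
rewrite split_out leq_add2r inner; apply: leq_sum => x _.
exact/fsubset_leq_card/fsubsetIl.
Qed.

End Expansion.

(** * Valuations *)

Section Valuation.
Variables (K : fieldType) (ord : K -> int) (hK : local_field ord).
Variables (pi : K) (hpi : uniformizer ord pi).
Implicit Types (x y a : K) (M N k : int).

Lemma pi_neq0 : pi != 0. Proof. by case: hpi. Qed.

Lemma piX_neq0 k : pi ^ k != 0. Proof. exact/expfz_neq0/pi_neq0. Qed.

Lemma ord1 : ord 1 = 0.
Proof.
have e : ord 1 = ord 1 + ord 1 by rewrite -[in LHS](mulr1 1) (ord_mul hK) ?oner_neq0.
lia.
Qed.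

Lemma ordN x : ord (- x) = ord x.
Proof.
have [->|x0] := eqVneq x 0; first by rewrite oppr0.
have N1 : (-1 : K) != 0 by rewrite oppr_eq0 oner_neq0.
have e : ord (-1) + ord (-1) = 0 by rewrite -(ord_mul hK) // mulrNN mulr1 ord1.
by rewrite -mulN1r (ord_mul hK) //; lia.
Qed.

Lemma ordV x : x != 0 -> ord x^-1 = - ord x.
Proof.
move=> x0; have e : ord x + ord x^-1 = 0.
  by rewrite -(ord_mul hK) ?invr_neq0 // divff // ord1.
lia.
Qed.

Lemma ord_piX k : ord (pi ^ k) = k.
Proof.
have natX (m : nat) : ord (pi ^+ m) = m.
  elim: m => [|m IH]; first exact: ord1.
  by rewrite exprS (ord_mul hK) ?expf_neq0 ?pi_neq0 // IH hpi.2; lia.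
case: k => m; first exact: natX.
by rewrite NegzE -exprnN ordV ?expf_neq0 ?pi_neq0 // natX.
Qed.

Lemma ord_ge_le M N x : M <= N -> ord_ge ord N x -> ord_ge ord M x.
Proof. by move=> MN [->|xN]; [left | right; lia]. Qed.

Lemma ord_ge_0 N : ord_ge ord N 0. Proof. by left. Qed.

Lemma ord_geD N x y : ord_ge ord N x -> ord_ge ord N y -> ord_ge ord N (x + y).
Proof.
move=> [->|xN]; first by rewrite add0r.
move=> [->|yN]; first by rewrite addr0; right.
have [->|x0] := eqVneq x 0; first by rewrite add0r; right.
have [->|y0] := eqVneq y 0; first by rewrite addr0; right.
have [->|s0] := eqVneq (x + y) 0; first by left.
by right; apply: le_trans (ord_add hK x0 y0 s0); rewrite le_min xN yN.
Qed.

Lemma ord_geN N x : ord_ge ord N x -> ord_ge ord N (- x).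
Proof. by move=> [->|xN]; [left; rewrite oppr0 | right; rewrite ordN]. Qed.

Lemma ord_geB N x y : ord_ge ord N x -> ord_ge ord N y -> ord_ge ord N (x - y).
Proof. by move=> xN yN; apply: ord_geD => //; apply: ord_geN. Qed.

Lemma ord_geM M N x y :
  ord_ge ord M x -> ord_ge ord N y -> ord_ge ord (M + N) (x * y).
Proof.
have [->|x0] := eqVneq x 0; first by left; rewrite mul0r.
have [->|y0] := eqVneq y 0; first by left; rewrite mulr0.
move=> [xe|xM]; first by rewrite xe eqxx in x0.
move=> [ye|yN]; first by rewrite ye eqxx in y0.
by right; rewrite (ord_mul hK) // lerD.
Qed.

Lemma ord_ge_sum N (I : Type) (r : seq I) (P : pred I) (F : I -> K) :
  (forall i, P i -> ord_ge ord N (F i)) -> ord_ge ord N (\sum_(i <- r | P i) F i).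
Proof. by move=> H; elim/big_ind: _ => //; [left | exact: ord_geD]. Qed.

Lemma ord_ge_refl x : ord_ge ord (ord x) x. Proof. by right. Qed.

Lemma ord_ge_mul a N x : a != 0 ->
  ord_ge ord N (a * x) <-> ord_ge ord (N - ord a) x.
Proof.
move=> a0; split=> h.
  have := ord_geM (ord_ge_refl a^-1) h; rewrite mulKf // ordV // addrC; exact.
by have := ord_geM (ord_ge_refl a) h; rewrite addrC subrK.
Qed.

Lemma ord_ge_piX k N x : ord_ge ord N (pi ^ k * x) <-> ord_ge ord (N - k) x.
Proof. by rewrite ord_ge_mul ?piX_neq0 // ord_piX. Qed.

Lemma ord_ge_unbounded x : (forall k : nat, ord_ge ord k x) -> x = 0.
Proof. by move=> /(_ `|ord x|.+1) [//|]; lia. Qed.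

Lemma ord_ge_eventually x N : exists k : nat, forall j : nat, (k <= j)%N ->
  ord_ge ord N (pi ^ j%:Z * x).
Proof.
by exists (`|N - ord x|)%N => j kj; apply/ord_ge_piX; right; lia.
Qed.

Lemma ord_ge_eventually_fin (I : finType) (f : I -> K) N :
  exists k : nat, forall i, ord_ge ord N (pi ^ k%:Z * f i).
Proof.
have [k kP] := choice (fun i => ord_ge_eventually (f i) N).
by exists (\max_i k i)%N => i; apply: kP; apply: leq_bigmax.
Qed.

Lemma pi_idealE x : pi_ideal ord pi x <-> ord_ge ord 1 x.
Proof.
split=> [[y Oy <-]|x1].
  by apply/(ord_ge_piX 1); rewrite subrr.
exists (pi^-1 * x); last by rewrite mulVKf // pi_neq0.
exact/(ord_ge_piX (-1)).
Qed.

(** One element is chosen in each of the finitely many cosets. *)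
Lemma finite_residue_representatives :
  exists C : set K, finite_set C /\
    forall c, ord_ge ord 0 c -> exists2 r, C r & ord_ge ord 1 (c - r).
Proof.
exists ((fun S => xget 0 S) @` residue_field ord); split.
  exact/finite_image/residue_finite.
move=> c Oc; set S : set K := [set c + m | m in maximal_ideal ord].
exists (xget 0 S); first by exists S => //; exists c.
have : S (xget 0 S) by apply: (@xgetPex _ 0 S); exists (c + 0), 0 => //; left.
by move=> [m m1 <-]; rewrite opprD addNKr; apply: ord_geN.
Qed.

End Valuation.

(** * Symplectic bases *)

Section SymplecticBasis.
Variables (K : fieldType) (V : vectType K) (B : {biscalar V}).
Hypothesis hBalt : alternating_form B.

Lemma alternating_skew x y : B x y = - B y x.
Proof.
have := hBalt (x + y); rewrite linearDl !linearDr !hBalt add0r addr0 => /eqP.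
by rewrite addr_eq0 => /eqP.
Qed.

(** The relations of a symplectic basis for a family of any size, so that a
    basis can be built up one hyperbolic pair at a time. *)
Definition symplectic_family m (u w : m.-tuple V) :=
  [/\ forall i j, B (tnth u i) (tnth w j) = (i == j)%:R,
      forall i j, B (tnth u i) (tnth u j) = 0
    & forall i j, B (tnth w i) (tnth w j) = 0].

Section Family.
Variables (m : nat) (u w : m.-tuple V).
Hypothesis suw : symplectic_family u w.

Lemma form_comb_w (c d : 'I_m -> K) j :
  B (\sum_i c i *: tnth u i + \sum_i d i *: tnth w i) (tnth w j) = c j.
Proof.
have [uw _ ww] := suw; rewrite linearDl !linear_sumlz.
rewrite [X in _ + X]big1 => [|i _]; last by rewrite linearZl_LR ww mulr0.
rewrite addr0 (bigD1 j) //= linearZl_LR uw eqxx mulr1 big1 ?addr0 // => i ij.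
by rewrite linearZl_LR uw (negPf ij) mulr0.
Qed.

Lemma form_comb_u (c d : 'I_m -> K) j :
  B (tnth u j) (\sum_i c i *: tnth u i + \sum_i d i *: tnth w i) = d j.
Proof.
have [uw uu _] := suw; rewrite linearDr !linear_sumr.
rewrite big1 => [|i _]; last by rewrite linearZr_LR uu mulr0.
rewrite add0r (bigD1 j) //= linearZr_LR uw eqxx mulr1 big1 ?addr0 // => i ij.
by rewrite linearZr_LR uw eq_sym (negPf ij) mulr0.
Qed.

(** The projection onto the span of the family along its orthogonal. *)
Definition hyperbolic_part x :=
  \sum_i B x (tnth w i) *: tnth u i + \sum_i B (tnth u i) x *: tnth w i.

Lemma residual_w x j : B (x - hyperbolic_part x) (tnth w j) = 0.
Proof. by rewrite linearBl form_comb_w subrr. Qed.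

Lemma residual_u x j : B (x - hyperbolic_part x) (tnth u j) = 0.
Proof. by rewrite alternating_skew linearBr form_comb_u subrr oppr0. Qed.

Lemma hyperbolic_part_span x : hyperbolic_part x \in <<u ++ w>>%VS.
Proof.
apply: rpredD; apply: rpred_sum => i _; apply: rpredZ; apply: memv_span;
  by rewrite mem_cat mem_tnth ?orbT.
Qed.

Lemma symplectic_family_free : free (u ++ w).
Proof.
apply/(@freeP _ _ _ [tuple of u ++ w]) => k.
rewrite big_split_ord /=.
under eq_bigr => i _ do
  rewrite nth_cat size_tuple ltn_ord -tnth_nth.
under [X in _ + X]eq_bigr => i _ do
  rewrite nth_cat size_tuple ltnNge leq_addr /= addKn -tnth_nth.
move=> k0 i; case: (split_ordP i) => j ->.
  rewrite -(form_comb_w (fun j => k (lshift m j)) (fun j => k (rshift m j))).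
  by rewrite k0 linear0l.
rewrite -(form_comb_u (fun j => k (lshift m j)) (fun j => k (rshift m j))).
by rewrite k0 linear0r.
Qed.

End Family.

Lemma symplectic_coord m (u w : m.-tuple V) x :
  symplectic_basis B u w -> x = hyperbolic_part u w x.
Proof.
move=> [buw uw uu ww]; have suw : symplectic_family u w by [].
have : x \in <<u ++ w>>%VS by rewrite (span_basis buw) memvf.
move=> /(@coord_span _ _ _ [tuple of u ++ w]).
rewrite big_split_ord /=.
under eq_bigr => i _ do
  rewrite nth_cat size_tuple ltn_ord -tnth_nth.
under [X in _ + X]eq_bigr => i _ do
  rewrite nth_cat size_tuple ltnNge leq_addr /= addKn -tnth_nth.
pose c i := coord [tuple of u ++ w] (lshift m i) x.
pose d i := coord [tuple of u ++ w] (rshift m i) x.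
rewrite -/(\sum_i c i *: tnth u i) -/(\sum_i d i *: tnth w i) => xE.
rewrite /hyperbolic_part [LHS]xE; congr (_ + _); apply: eq_bigr => i _.
  by rewrite [in RHS]xE form_comb_w.
by rewrite [in RHS]xE form_comb_u.
Qed.

Hypothesis hBnd : nondegenerate_form B.

Lemma nondegenerate_pair x : x != 0 -> exists y, B x y != 0.
Proof.
move=> x0; apply: contrapT => h; case/eqP: x0; apply: hBnd => y.
by apply/eqP; apply: contrapT => /negP y0; apply: h; exists y.
Qed.

(** A vector outside the span has a non-zero component orthogonal to the
    family; by non-degeneracy it pairs with some vector, whose own orthogonal
    component completes a new hyperbolic pair. *)
Lemma symplectic_family_extend m (u w : m.-tuple V) :
  symplectic_family u w -> (2 * m < \dim {:V})%N ->
  exists u' w' : m.+1.-tuple V, symplectic_family u' w'.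
Proof.
move=> suw ltmV; have [uw uu ww] := suw.
have /subvPn[z _ zN] : ~~ (fullv <= <<u ++ w>>)%VS.
  apply/negP => /dimvS; apply/negP; rewrite -ltnNge.
  by apply: leq_ltn_trans (dim_span _) _; rewrite size_cat !size_tuple addnn -mul2n.
set x := z - hyperbolic_part u w z.
have x0 : x != 0.
  apply: contra zN; rewrite subr_eq0 => /eqP ->; exact: hyperbolic_part_span.
have [y yx] := nondegenerate_pair x0.
set y' := (B x y)^-1 *: (y - hyperbolic_part u w y).
have xw j : B x (tnth w j) = 0 by exact: residual_w.
have xu j : B x (tnth u j) = 0 by exact: residual_u.
have yw j : B y' (tnth w j) = 0 by rewrite linearZl_LR residual_w ?mulr0.
have yu j : B y' (tnth u j) = 0 by rewrite linearZl_LR residual_u ?mulr0.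
have xy : B x y' = 1.
  rewrite linearZr_LR linearBr linearDr !linear_sumr.
  rewrite big1 => [|i _]; last by rewrite linearZr_LR xu mulr0.
  rewrite big1 => [|i _]; last by rewrite linearZr_LR xw mulr0.
  by rewrite addr0 subr0 mulVf.
exists [tuple of x :: u], [tuple of y' :: w]; split=> i j.
- case: (unliftP ord0 i) => [i' ->|->]; case: (unliftP ord0 j) => [j' ->|->];
    rewrite ?tnthS ?tnth0 ?xy ?xw ?uw //.
  by rewrite alternating_skew yu oppr0.
- case: (unliftP ord0 i) => [i' ->|->]; case: (unliftP ord0 j) => [j' ->|->];
    rewrite ?tnthS ?tnth0 ?hBalt //.
  by rewrite alternating_skew xu oppr0.
- case: (unliftP ord0 i) => [i' ->|->]; case: (unliftP ord0 j) => [j' ->|->];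
    rewrite ?tnthS ?tnth0 ?hBalt //.
  by rewrite alternating_skew yw oppr0.
Qed.

Lemma symplectic_basis_exists n : \dim {:V} = (2 * n)%N ->
  exists u w : n.-tuple V, symplectic_basis B u w.
Proof.
move=> dimV.
suff fam m : (m <= n)%N -> exists u w : m.-tuple V, symplectic_family u w.
  have [u [w suw]] := fam n (leqnn n); exists u, w.
  case: (suw) => uw uu ww; split=> //.
  rewrite basisEfree (symplectic_family_free suw) subvf size_cat !size_tuple.
  by rewrite dimV addnn mul2n leqnn.
elim: m => [_|m IH ltmn]; first by exists [tuple], [tuple]; split; case.
have [u [w suw]] := IH (ltnW ltmn).
by apply: (symplectic_family_extend suw); rewrite dimV ltn_pmul2l.
Qed.

End SymplecticBasis.
(** * Lattices that are dual to a multiple of themselves *)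

Section Lattices.
Variables (K : fieldType) (ord : K -> int) (hK : local_field ord).
Variables (pi : K) (hpi : uniformizer ord pi).
Variables (V : vectType K) (B : {biscalar V}).
Hypotheses (hBalt : alternating_form B) (hBnd : nondegenerate_form B).
Implicit Types (L M : set V) (s : int) (x y : V).

Lemma mem_dilate a L x : a != 0 -> dilate a L x <-> L (a^-1 *: x).
Proof.
move=> a0; split=> [[y Ly <-]|Lx]; first by rewrite scalerK.
by exists (a^-1 *: x); rewrite // scalerKV.
Qed.

Lemma dilate_dilate a b L : dilate a (dilate b L) = dilate (a * b) L.
Proof.
rewrite eqEsubset; split=> x.
  by move=> [_ [y Ly <-] <-]; exists y; rewrite // scalerA.
by move=> [y Ly <-]; exists (b *: y); [exists y | rewrite scalerA].
Qed.

Lemma dilate1 L : dilate 1 L = L.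
Proof.
rewrite eqEsubset; split=> x; first by move=> [y Ly <-]; rewrite scale1r.
by exists x; rewrite ?scale1r.
Qed.

Lemma dilateS a L M : L `<=` M -> dilate a L `<=` dilate a M.
Proof. exact: image_subset. Qed.

(** Excludes the degenerate solutions of the self-duality equation below, such
    as a Lagrangian subspace of V. *)
Definition absorbing L := forall x, exists k : nat, L (pi ^ k%:Z *: x).

(** The dual of [L] is pi^(-s) L. The equivalence alone makes [L] a module over
    the valuation ring; primitive lattices are the case s = 0, and all
    representatives of special vertices are of this kind
    ([special_modular]). *)
Definition modular s L := absorbing L /\
  forall x, L x <-> forall y, L y -> ord_ge ord s (B x y).

Lemma absorbing_dilate a L : a != 0 -> absorbing L -> absorbing (dilate a L).
Proof.
move=> a0 absL x; have [k Lk] := absL (a^-1 *: x).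
by exists k; apply/mem_dilate => //; rewrite scalerA mulrC -scalerA.
Qed.

Lemma modular_dilate a s L : a != 0 -> modular s L ->
  modular (s + 2%:Z * ord a) (dilate a L).
Proof.
move=> a0 [absL Ls]; split; first exact: absorbing_dilate.
have tr x y : ord_ge ord (s + 2%:Z * ord a) (B x (a *: y)) <->
    ord_ge ord s (B (a^-1 *: x) y).
  rewrite linearZr_LR linearZl_LR (ord_ge_mul hK) // (ord_ge_mul hK) ?invr_neq0 //.
  by rewrite (ordV hK) // [s - _](_ : _ = s + 2%:Z * ord a - ord a) //; lia.
move=> x; rewrite mem_dilate // Ls; split=> [h _ [y Ly <-]|h y Ly].
  exact/tr/h.
by apply/tr/h; exists y.
Qed.

Section Modular.
Variables (s : int) (L : set V).
Hypothesis Ls : modular s L.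

Lemma modular_form x y : L x -> L y -> ord_ge ord s (B x y).
Proof. by move=> /Ls.2; apply. Qed.

Lemma modularD x y : L x -> L y -> L (x + y).
Proof.
move=> Lx Ly; apply/Ls.2 => z Lz; rewrite linearDl.
by apply: (ord_geD hK); apply: modular_form.
Qed.

Lemma modularZ c x : ord_ge ord 0 c -> L x -> L (c *: x).
Proof.
move=> Oc Lx; apply/Ls.2 => z Lz; rewrite linearZl_LR -[s]add0r.
by apply: (ord_geM hK) => //; apply: modular_form.
Qed.

Lemma modularN x : L x -> L (- x).
Proof.
move=> Lx; rewrite -scaleN1r; apply: modularZ => //.
by right; rewrite (ordN hK) (ord1 hK).
Qed.

Lemma modularB x y : L x -> L y -> L (x - y).
Proof. by move=> Lx Ly; apply/modularD/modularN. Qed.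

Lemma modular_piX (j k : int) x : j <= k ->
  L (pi ^ j *: x) -> L (pi ^ k *: x).
Proof.
move=> jk Lj; rewrite -[k](subrK j) expfzDr ?(pi_neq0 hpi) // -scalerA.
by apply: modularZ => //; right; rewrite (ord_piX hK hpi); lia.
Qed.

Lemma dilate_unit a : a != 0 -> ord a = 0 -> dilate a L = L.
Proof.
move=> a0 ua; rewrite eqEsubset; split=> x.
  by move=> [y Ly <-]; apply: modularZ => //; right; rewrite ua.
move=> Lx; apply/mem_dilate => //; apply: modularZ => //.
by right; rewrite (ordV hK) // ua.
Qed.

Lemma dilate_piX a : a != 0 -> dilate a L = dilate (pi ^ ord a) L.
Proof.
move=> a0; have p0 := piX_neq0 hpi (ord a).
rewrite -[in RHS](@dilate_unit (a / pi ^ ord a)) ?dilate_dilate.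
- by rewrite mulrC divfK.
- by rewrite mulf_neq0 ?invr_neq0.
- by rewrite (ord_mul hK) ?invr_neq0 // (ordV hK) // (ord_piX hK hpi) subrr.
Qed.

(** If all pi^(-k) x lay in [L], their pairings with a vector of [L] not
    orthogonal to [x] would have unbounded negative valuation. *)
Lemma modular_not_divisible x : x != 0 ->
  exists k : nat, ~ L (pi ^ (- k%:Z) *: x).
Proof.
move=> x0; have [y xy] := nondegenerate_pair hBnd x0.
have [j Lj] := Ls.1 y; apply: contrapT => h.
case/eqP: xy; apply: (ord_ge_unbounded (ord := ord)) => N.
(* This k makes the pairing of pi^(-k) x and pi^j y show N <= ord <x,y>. *)
pose k := `|(N%:Z + j%:Z - s)%R|%N.
have Lk : L (pi ^ (- k%:Z) *: x) by apply: contrapT => nL; apply: h; exists k.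
have := modular_form Lk Lj; rewrite linearZl_LR linearZr_LR.
by rewrite !(ord_ge_piX hK hpi); apply: ord_ge_le; rewrite /k; lia.
Qed.

(** A module stable under pi^-1 is a vector space, which a modular [L] cannot
    be unless V = 0. This is how exponents s are compared below. *)
Lemma modular_divisible_eq0 : (forall x, L x -> L (pi^-1 *: x)) ->
  forall x, x = 0.
Proof.
move=> divL x; apply/eqP; apply: contrapT => /negP x0.
have [k nLk] := modular_not_divisible x0.
have [j Lj] := Ls.1 x; apply: nLk.
suff all_k (i : nat) : L (pi ^ (j%:Z - i%:Z) *: x).
  by have := all_k (j + k)%N; congr (L (pi ^ _ *: x)); lia.
elim: i => [|i IH]; first by rewrite subr0.
have := divL _ IH; rewrite scalerA -exprN1 -expfzDr ?(pi_neq0 hpi) //.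
by congr (L (pi ^ _ *: x)); lia.
Qed.

Lemma modular_minimal_multiple x : x != 0 ->
  exists m : int, L (pi ^ m *: x) /\ ~ L (pi ^ (m - 1) *: x).
Proof.
move=> x0; have [k nLk] := modular_not_divisible x0; have [j Lj] := Ls.1 x.
apply: contrapT => h.
suff all_k (i : nat) : L (pi ^ (j%:Z - i%:Z) *: x).
  by apply: nLk; have := all_k (j + k)%N; congr (L (pi ^ _ *: x)); lia.
elim: i => [|i IH]; first by rewrite subr0.
apply: contrapT => nL; apply: h; exists (j%:Z - i%:Z); split=> //.
by move: nL; congr (~ L (pi ^ _ *: x)); lia.
Qed.

End Modular.

Lemma modular_inj s s' L : (exists x : V, x != 0) ->
  modular s L -> modular s' L -> s = s'.
Proof.
move=> [v v0].
have ge_s t t' : modular t L -> modular t' L -> t' <= t.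
  move=> Lt Lt'; rewrite leNgt; apply/negP => tt'.
  case/eqP: v0; apply: (modular_divisible_eq0 Lt) => x Lx; apply/Lt.2 => y Ly.
  rewrite linearZl_LR -exprN1 (ord_ge_piX hK hpi).
  by apply: ord_ge_le (modular_form Lt' Lx Ly); lia.
by move=> Ls Ls'; apply/le_anti/andP; split; apply: ge_s.
Qed.

(** Both lattices are pi^s times their duals, and duality reverses
    inclusions. *)
Lemma modular_sub_eq s L M : modular s L -> modular s M -> L `<=` M -> L = M.
Proof.
move=> Ls Ms LM; rewrite eqEsubset; split=> // x Mx; apply/Ls.2 => y Ly.
by apply: (modular_form Ms) => //; apply: LM.
Qed.

Lemma modular_homothety_eq s L M a : (exists x : V, x != 0) -> a != 0 ->
  modular s L -> modular s M -> M = dilate a L -> M = L.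
Proof.
move=> v a0 Ls Ms ME; rewrite ME (dilate_unit Ls) //.
have Ms' := modular_dilate a0 Ls; rewrite -ME in Ms'.
have := modular_inj v Ms Ms'; lia.
Qed.

Section Rank.
Variable n : nat.
Hypothesis hV : \dim {:V} = (2 * n)%N.

(** Independence over the valuation ring implies independence over the field,
    by clearing denominators; so the generators form a basis of V. *)
Lemma lattice_absorbing L : lattice ord n L -> absorbing L.
Proof.
move=> [e [indep LE]] x; pose p0 := piX_neq0 hpi.
have free_e : free e.
  apply/freeP => c; under eq_bigr do rewrite -tnth_nth; move=> c0 i.
  have [k kP] := ord_ge_eventually_fin hK hpi c 0.
  suff : pi ^ k%:Z * c i = 0 by move/eqP; rewrite mulf_eq0 (negPf (p0 _)) => /eqP.
  apply: (indep (fun i => pi ^ k%:Z * c i)) => //.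
  under eq_bigr do rewrite -scalerA.
  by rewrite -scaler_sumr c0 scaler0.
have be : basis_of fullv e.
  by rewrite basisEfree free_e subvf size_tuple hV leqnn.
have xe : x \in <<e>>%VS by rewrite (span_basis be) memvf.
have [k kP] := ord_ge_eventually_fin hK hpi (fun i => coord e i x) 0.
exists k; rewrite LE; exists (fun i => pi ^ k%:Z * coord e i x); split=> //.
rewrite {1}(coord_span xe) scaler_sumr; apply: eq_bigr => i _.
by rewrite scalerA -tnth_nth.
Qed.

(** The non-degeneracy modulo pi says that a vector of [L] pairing [L] into
    (pi) is divisible by pi in [L]; if pi^k x is in [L] and [x] pairs [L] into
    the valuation ring, this removes the k factors pi one at a time. *)
Lemma primitive_modular L : primitive ord pi n B L -> modular 0 L.
Proof.
move=> [latL formL ndL]; have absL := lattice_absorbing latL.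
split=> // x; split=> [Lx y Ly|]; first exact: formL.
have [k] := absL x; elim: k => [|k IH] Lk dual; first by move: Lk; rewrite scale1r.
apply: IH => //; have /mem_dilate : dilate pi L (pi ^ k.+1%:Z *: x).
  apply: ndL => // y Ly; apply/(pi_idealE hK hpi).
  rewrite linearZl_LR (ord_ge_piX hK hpi).
  by apply: ord_ge_le (dual _ Ly); lia.
rewrite scalerA -exprN1 -expfzDr ?(pi_neq0 hpi) // => /(_ isT).
by congr (L (pi ^ _ *: x)); lia.
Qed.

(** Lets the generators be indexed by n + n instead of the non-convertible
    2 * n. *)
Lemma lattice_of_tuple m (e : m.-tuple V) L : m = (2 * n)%N ->
  (forall c : 'I_m -> K, \sum_i c i *: tnth e i = 0 -> forall i, c i = 0) ->
  L = [set x | exists c : 'I_m -> K,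
        (forall i, ord_ge ord 0 (c i)) /\ x = \sum_i c i *: tnth e i] ->
  lattice ord n L.
Proof.
move=> Em indep LE; subst m; exists e; split=> // c _; exact: indep.
Qed.

Section SymplecticLattice.
Variables (u w : n.-tuple V).
Hypothesis buw : symplectic_basis B u w.


Let suw : symplectic_family B u w. Proof. by case: buw. Qed.

(** The coordinates in a symplectic basis are pairings with basis vectors. *)
Lemma mem_lattice_of a b x : lattice_of ord pi u w a b x <->
  forall i, ord_ge ord (a i) (B x (tnth w i)) /\
            ord_ge ord (b i) (B (tnth u i) x).
Proof.
have OpiX c k : ord_ge ord k (c * pi ^ k) <-> ord_ge ord 0 c.
  by rewrite mulrC (ord_ge_piX hK hpi) subrr.
split=> [[c [d [Oc Od ->]]] i|h].
  rewrite (form_comb_w suw (fun i => c i * pi ^ a i) (fun i => d i * pi ^ b i)).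
  rewrite (form_comb_u suw (fun i => c i * pi ^ a i) (fun i => d i * pi ^ b i)).
  by split; apply/OpiX; [exact: Oc | exact: Od].
exists (fun i => B x (tnth w i) / pi ^ a i), (fun i => B (tnth u i) x / pi ^ b i).
split=> [i|i|].
- by apply/(OpiX _ (a i)); rewrite divfK ?(piX_neq0 hpi) //; case: (h i).
- by apply/(OpiX _ (b i)); rewrite divfK ?(piX_neq0 hpi) //; case: (h i).
- rewrite {1}(symplectic_coord x buw); congr (_ + _);
    by apply: eq_bigr => i _; rewrite divfK ?(piX_neq0 hpi).
Qed.

Lemma lattice_of_lattice a b : lattice ord n (lattice_of ord pi u w a b).
Proof.
pose u' := [tuple pi ^ a i *: tnth u i | i < n].
pose w' := [tuple pi ^ b i *: tnth w i | i < n].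
have sumE (c : 'I_(n + n) -> K) :
    \sum_i c i *: tnth [tuple of u' ++ w'] i =
    \sum_i (c (lshift n i) * pi ^ a i) *: tnth u i +
    \sum_i (c (rshift n i) * pi ^ b i) *: tnth w i.
  rewrite big_split_ord /=; congr (_ + _); apply: eq_bigr => i _.
    by rewrite tnth_lshift tnth_mktuple scalerA.
  by rewrite tnth_rshift tnth_mktuple scalerA.
apply: (@lattice_of_tuple _ [tuple of u' ++ w']); first by rewrite addnn mul2n.
  move=> c; rewrite sumE => c0.
  have kill k (z : K) : z * pi ^ k = 0 -> z = 0.
    by move/eqP; rewrite mulf_eq0 (negPf (piX_neq0 hpi k)) orbF => /eqP.
  move=> i; case: (split_ordP i) => j ->.
    apply: (kill (a j)).
    rewrite -(form_comb_w suw (fun j => c (lshift n j) * pi ^ a j)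
      (fun j => c (rshift n j) * pi ^ b j)).
    by rewrite c0 linear0l.
  apply: (kill (b j)).
  rewrite -(form_comb_u suw (fun j => c (lshift n j) * pi ^ a j)
      (fun j => c (rshift n j) * pi ^ b j)).
  by rewrite c0 linear0r.
rewrite eqEsubset; split=> x.
  move=> [c [d [Oc Od ->]]].
  exists (fun i => match split i with inl j => c j | inr j => d j end).
  split=> [i|]; first by case: (split i).
  rewrite sumE; congr (_ + _); apply: eq_bigr => i _.
    by rewrite (unsplitK (inl i)).
  by rewrite (unsplitK (inr i)).
move=> [c [Oc ->]]; rewrite sumE.
exists (fun i => c (lshift n i)), (fun i => c (rshift n i)).
by split=> // i; apply: Oc.
Qed.

Lemma dilate_lattice_of a b k :
  dilate (pi ^ k) (lattice_of ord pi u w a b) =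
  lattice_of ord pi u w (fun i => a i + k) (fun i => b i + k).
Proof.
have shift N z : ord_ge ord N ((pi ^ k)^-1 * z) <-> ord_ge ord (N + k) z.
  by rewrite (ord_ge_mul hK) ?invr_neq0 ?(piX_neq0 hpi) // (ordV hK)
    ?(piX_neq0 hpi) // (ord_piX hK hpi) opprK.
have scaled x i : (ord_ge ord (a i) (B ((pi ^ k)^-1 *: x) (tnth w i)) /\
      ord_ge ord (b i) (B (tnth u i) ((pi ^ k)^-1 *: x))) <->
    (ord_ge ord (a i + k) (B x (tnth w i)) /\
      ord_ge ord (b i + k) (B (tnth u i) x)).
  by rewrite linearZl_LR linearZr_LR !shift.
rewrite eqEsubset; split=> x; rewrite mem_dilate ?(piX_neq0 hpi) // => /mem_lattice_of h.
  by apply/mem_lattice_of => i; apply/scaled.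
by apply/mem_lattice_of => i; apply/scaled.
Qed.

Lemma lattice_ofS a b a' b' : (forall i, a' i <= a i) -> (forall i, b' i <= b i) ->
  lattice_of ord pi u w a b `<=` lattice_of ord pi u w a' b'.
Proof.
move=> aa' bb' x; rewrite !mem_lattice_of => h i; have [hw hu] := h i.
by split; [apply: ord_ge_le hw | apply: ord_ge_le hu].
Qed.

Lemma form_coord x y : B x y =
  \sum_i B x (tnth w i) * B (tnth u i) y - \sum_i B (tnth u i) x * B y (tnth w i).
Proof.
rewrite {1}(symplectic_coord x buw) linearDl !linear_sumlz.
congr (_ + _).
  by apply: eq_bigr => i _; rewrite linearZl_LR.
rewrite -sumrN; apply: eq_bigr => i _.
by rewrite linearZl_LR (alternating_skew hBalt (tnth w i)) mulrN.
Qed.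

(** The dual of the lattice with exponents (a, b) has exponents (-b, -a). *)
Lemma lattice_of_modular a b s : (forall i, a i + b i = s) ->
  modular s (lattice_of ord pi u w a b).
Proof.
move=> ab; split; first exact/lattice_absorbing/lattice_of_lattice.
have [uw uu ww] := suw.
move=> x; rewrite mem_lattice_of; split=> [hx y /mem_lattice_of hy|h i].
  rewrite form_coord; apply: (ord_geB hK); apply: (ord_ge_sum hK) => i _.
    rewrite -(ab i); apply: (ord_geM hK); [by case: (hx i) | by case: (hy i)].
  rewrite -(ab i) addrC; apply: (ord_geM hK); [by case: (hx i) | by case: (hy i)].
split.
  have Lw : lattice_of ord pi u w a b (pi ^ b i *: tnth w i).
    apply/mem_lattice_of => j; rewrite linearZl_LR linearZr_LR ww mulr0 uw.
    split; first exact: ord_ge_0.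
    have [->|_] := eqVneq j i; last by rewrite mulr0; left.
    by rewrite mulr1; right; rewrite (ord_piX hK hpi).
  have := h _ Lw; rewrite linearZr_LR (ord_ge_piX hK hpi) -(ab i) addrK; exact.
have Lu : lattice_of ord pi u w a b (pi ^ a i *: tnth u i).
  apply/mem_lattice_of => j; rewrite linearZl_LR linearZr_LR uu mulr0 uw.
  split; last exact: ord_ge_0.
  have [->|_] := eqVneq i j; last by rewrite mulr0; left.
  by rewrite mulr1; right; rewrite (ord_piX hK hpi).
have := h _ Lu; rewrite linearZr_LR (ord_ge_piX hK hpi) -(ab i) [a i + _]addrC addrK.
by rewrite (alternating_skew hBalt) => /(ord_geN hK); rewrite opprK.
Qed.

Lemma lattice_of_primitive a b : (forall i, a i + b i = 0) ->
  primitive ord pi n B (lattice_of ord pi u w a b).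
Proof.
move=> ab; have L0 := lattice_of_modular ab; split.
- exact: lattice_of_lattice.
- by move=> x y Lx Ly; apply: (modular_form L0).
- move=> x Lx h; apply/mem_dilate; first exact: pi_neq0 hpi.
  apply/L0.2 => y Ly; rewrite linearZl_LR -exprN1 (ord_ge_piX hK hpi).
  by have /(pi_idealE hK hpi) := h y Ly.
Qed.

End SymplecticLattice.

(** Representatives of L / pi L: combinations of a basis of [L] whose
    coefficients represent the residue field. *)
Lemma finite_lattice_mod_pi L : lattice ord n L ->
  exists F : set V, finite_set F /\
    forall x, L x -> exists2 f, F f & dilate pi L (x - f).
Proof.
move=> [e [_ LE]].
have [C [/finite_fsetP[C' CE] CP]] := finite_residue_representatives hK.
exists ((fun c : {ffun 'I_(2 * n) -> C'} => \sum_i val (c i) *: tnth e i) @` setT).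
split; first exact/finite_image/finite_finset.
move=> x; rewrite LE => -[c [Oc ->]].
have /choice[r rP] i : exists r : C', ord_ge ord 1 (c i - val r).
  have [r Cr rP] := CP _ (Oc i); rewrite CE /= in Cr.
  by exists [` Cr]%fset.
exists (\sum_i val (r i) *: tnth e i).
  by exists [ffun i => r i] => //; apply: eq_bigr => i _; rewrite ffunE.
apply/mem_dilate; first exact: pi_neq0 hpi.
exists (fun i => pi^-1 * (c i - val (r i))); split=> [i|].
  by rewrite -exprN1; apply/(ord_ge_piX hK hpi).
rewrite -sumrB scaler_sumr; apply: eq_bigr => i _.
by rewrite -scalerBl scalerA.
Qed.

(** A module between pi L and [L] is the union of the cosets of pi L through
    those representatives that it contains. *)
Lemma finite_intermediate L : lattice ord n L ->
  finite_set [set M | [/\ exists s, modular s M, dilate pi L `<=` M & M `<=` L]].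
Proof.
move=> /finite_lattice_mod_pi[F [/finite_fsetP[F' FE] FP]].
pose G (S : {fset V}) : set V := [set x | exists2 f, f \in S & dilate pi L (x - f)].
apply: (@sub_finite_set _ _ (G @` [set` fpowerset F'])); last first.
  exact/finite_image/finite_fset.
move=> M [[s Ms] LM ML].
exists [fset f in F' | `[< M f >]]%fset.
  by rewrite /= fpowersetE; apply/fsubsetP => f; rewrite !inE /= => /andP[].
rewrite eqEsubset; split=> x.
  move=> [f]; rewrite !inE /= => /andP[_ /asboolP Mf] /LM Mxf.
  by rewrite -(subrK f x); apply: (modularD Ms).
move=> Mx; have [f Ff xf] := FP x (ML _ Mx).
exists f => //; rewrite !inE /=; apply/andP; split; first by move: Ff; rewrite FE.
apply/asboolP; rewrite -[f](subKr x).
by apply: (modularB Ms) => //; apply: LM.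
Qed.

End Rank.
End Lattices.
(** * The action of isometries on vertices *)

Section Isometries.
Variables (K : fieldType) (ord : K -> int) (pi : K) (n : nat).
Variables (V : vectType K) (B : {biscalar V}) (g : {linear V -> V}).
Hypotheses (g_inj : injective g) (g_surj : forall y, exists x, g x = y).
Hypothesis g_form : forall x y, B (g x) (g y) = B x y.
Implicit Types (L : set V) (t : set (set V)).

Definition vertex_image (h : V -> V) t : set (set V) := [set h @` L | L in t].

Lemma mem_image L x : (g @` L) (g x) <-> L x.
Proof. by split=> [[y Ly /g_inj <-]|Lx] //; exists x. Qed.

Lemma image_lattice_inj : injective (fun L : set V => g @` L).
Proof.
move=> L M /= LM; rewrite eqEsubset; split=> x Lx; apply/mem_image.
  by rewrite -LM; apply/mem_image.
by rewrite LM; apply/mem_image.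
Qed.

Lemma vertex_image_inj : injective (vertex_image g).
Proof.
move=> t t' tt'; rewrite eqEsubset; split=> L tL.
  have : vertex_image g t' (g @` L) by rewrite -tt'; exists L.
  by move=> [M t'M /image_lattice_inj <-].
have : vertex_image g t (g @` L) by rewrite tt'; exists L.
by move=> [M t'M /image_lattice_inj <-].
Qed.

Lemma image_lattice L : lattice ord n L -> lattice ord n (g @` L).
Proof.
move=> [e [indep ->]]; exists (map_tuple g e).
have sumE (c : 'I_(2 * n) -> K) :
    \sum_i c i *: tnth (map_tuple g e) i = g (\sum_i c i *: tnth e i).
  by rewrite linear_sum; apply: eq_bigr => i _; rewrite tnth_map linearZ.
split=> [c Oc|].
  by rewrite sumE => ce0; apply: indep => //; apply: g_inj; rewrite ce0 linear0.
rewrite eqEsubset; split=> y.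
  by move=> [_ [c [Oc ->]] <-]; exists c; rewrite sumE.
by move=> [c [Oc ->]]; exists (\sum_i c i *: tnth e i); [exists c | rewrite sumE].
Qed.

Lemma image_dilate a L : g @` dilate a L = dilate a (g @` L).
Proof.
rewrite eqEsubset; split=> y.
  by move=> [_ [x Lx <-] <-]; exists (g x); [exists x | rewrite linearZ].
by move=> [_ [x Lx <-] <-]; exists (a *: x); [exists x | rewrite linearZ].
Qed.

Lemma image_homothety_class L :
  vertex_image g (homothety_class L) = homothety_class (g @` L).
Proof.
rewrite eqEsubset; split=> M.
  by move=> [_ [a a0 ->] <-]; exists a => //; rewrite image_dilate.
by move=> [a a0 ->]; exists (dilate a L); [exists a | rewrite image_dilate].
Qed.

Lemma image_form_in L (S : set K) : form_in B L S -> form_in B (g @` L) S.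
Proof. by move=> LS _ _ [x Lx <-] [y Ly <-]; rewrite g_form; apply: LS. Qed.

Lemma image_primitive L : primitive ord pi n B L -> primitive ord pi n B (g @` L).
Proof.
move=> [latL formL nd]; split; [exact: image_lattice | exact: image_form_in |].
move=> _ [x Lx <-] h; rewrite -image_dilate; exists x => //; apply: nd => // y Ly.
by rewrite -g_form; apply: h; exists y.
Qed.

Lemma image_building_vertex t :
  building_vertex ord pi n B t -> building_vertex ord pi n B (vertex_image g t).
Proof.
move=> [L [L0 [[latL ->] prim form piL0 LL0]]]; exists (g @` L), (g @` L0); split.
- by split; [exact: image_lattice | rewrite image_homothety_class].
- exact: image_primitive.
- exact: image_form_in.
- by rewrite -image_dilate; apply: image_subset.
- exact: image_subset.
Qed.

Lemma image_incident t t' : incident ord pi n B t t' ->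
  incident ord pi n B (vertex_image g t) (vertex_image g t').
Proof.
move=> [L [L' [L0 [[tL t'L'] prim formL formL' chain]]]].
exists (g @` L), (g @` L'), (g @` L0); split.
- by split; [exists L | exists L'].
- exact: image_primitive.
- exact: image_form_in.
- exact: image_form_in.
- rewrite -image_dilate; case: chain => -[h1 h2 h3]; [left | right];
    by split; apply: image_subset.
Qed.

Lemma image_adjacent t t' : adjacent ord pi n B t t' ->
  adjacent ord pi n B (vertex_image g t) (vertex_image g t').
Proof.
move=> [bt bt' tt' inc]; split; try exact: image_building_vertex.
- by move/vertex_image_inj.
- exact: image_incident.
Qed.

Lemma image_lattice_of (u w : n.-tuple V) a b :
  g @` lattice_of ord pi u w a b =
  lattice_of ord pi (map_tuple g u) (map_tuple g w) a b.
Proof.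
have sumE (c d : 'I_n -> K) :
    g (\sum_i (c i * pi ^ a i) *: tnth u i + \sum_i (d i * pi ^ b i) *: tnth w i) =
    \sum_i (c i * pi ^ a i) *: tnth (map_tuple g u) i +
    \sum_i (d i * pi ^ b i) *: tnth (map_tuple g w) i.
  rewrite linearD !linear_sum; congr (_ + _);
    by apply: eq_bigr => i _; rewrite tnth_map linearZ.
rewrite eqEsubset; split=> y.
  by move=> [_ [c [d [Oc Od ->]]] <-]; exists c, d; rewrite sumE.
move=> [c [d [Oc Od ->]]]; rewrite -sumE; apply: imageP.
by exists c, d.
Qed.

Lemma image_symplectic_basis (u w : n.-tuple V) :
  symplectic_basis B u w ->
  symplectic_basis B (map_tuple g u) (map_tuple g w).
Proof.
move=> [buw uw uu ww]; split.
- rewrite -map_cat /= basisEdim size_map; move: buw; rewrite basisEdim => /andP[sub ->].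
  rewrite andbT; apply/subvP => y _; have [x <-] := g_surj y.
  have : x \in <<u ++ w>>%VS by apply: (subvP sub); rewrite memvf.
  move=> /(@coord_span _ _ _ [tuple of u ++ w]) ->; rewrite linear_sum.
  apply: rpred_sum => i _; rewrite linearZ; apply/rpredZ/memv_span/map_f.
  by rewrite mem_nth // size_cat !size_tuple.
- by move=> i j; rewrite !tnth_map g_form.
- by move=> i j; rewrite !tnth_map g_form.
- by move=> i j; rewrite !tnth_map g_form.
Qed.

Lemma image_special_vertex t :
  special_vertex ord pi n B t -> special_vertex ord pi n B (vertex_image g t).
Proof.
move=> [bt [u [w [a [b [buw tL ab]]]]]]; split; first exact: image_building_vertex.
exists (map_tuple g u), (map_tuple g w), a, b; split=> //.
  exact: image_symplectic_basis.
by rewrite -image_lattice_of; exists (lattice_of ord pi u w a b).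
Qed.

Lemma image_modular s L : modular ord pi B s L -> modular ord pi B s (g @` L).
Proof.
move=> [absL Ls]; split=> y; have [x <-] := g_surj y.
  by have [k Lk] := absL x; exists k; rewrite -linearZ; apply/mem_image.
rewrite mem_image Ls; split=> [h _ [z Lz <-]|h z Lz].
  by rewrite g_form; apply: h.
by rewrite -g_form; apply: h; apply/mem_image.
Qed.

End Isometries.

(** * Symplectic transvections *)

Section Transvections.
Variables (K : fieldType) (V : vectType K) (B : {biscalar V}).
Hypothesis hBalt : alternating_form B.

Definition transvection (c : K) (f x : V) : V := x + (c * B x f) *: f.

Lemma transvection_is_linear c f : linear (transvection c f).
Proof.
move=> a x y; rewrite /transvection linearDl linearZl_LR mulrDr scalerDl scalerDr.
by rewrite scalerA mulrCA addrACA.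
Qed.

HB.instance Definition _ c f :=
  GRing.isLinear.Build K V V *:%R (transvection c f) (transvection_is_linear c f).

Lemma transvectionK c f : cancel (transvection c f) (transvection (- c) f).
Proof.
move=> x; rewrite /transvection linearDl linearZl_LR hBalt mulr0 addr0.
by rewrite mulNr scaleNr addrK.
Qed.

Lemma transvection_inj c f : injective (transvection c f).
Proof. exact: can_inj (transvectionK c f). Qed.

Lemma transvection_surj c f y : exists x, transvection c f x = y.
Proof.
exists (transvection (- c) f y).
by rewrite -{1}[c]opprK transvectionK.
Qed.

Lemma transvection_form c f x y :
  B (transvection c f x) (transvection c f y) = B x y.
Proof.
rewrite /transvection linearDl !linearDr !linearZl_LR !linearZr_LR hBalt.
by rewrite !mulr0 addr0 (alternating_skew hBalt f y) mulrN -addrA mulrAC subrr addr0.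
Qed.

End Transvections.
(** * Neighbours of a special vertex *)

Section SpecialGraph.
Variables (K : fieldType) (ord : K -> int) (hK : local_field ord).
Variables (pi : K) (hpi : uniformizer ord pi).
Variables (V : vectType K) (n : nat) (hV : \dim {:V} = (2 * n)%N).
Variables (B : {biscalar V}).
Hypotheses (hBalt : alternating_form B) (hBnd : nondegenerate_form B).
Variables (v : V) (v0 : v != 0).
Implicit Types (L M : set V) (t : set (set V)).

Local Notation modular := (modular ord pi B).
Local Notation vertex := (building_vertex ord pi n B).
Local Notation special := (special_vertex ord pi n B).
Local Notation adjacent := (adjacent ord pi n B).
Local Notation lattice := (lattice ord n).
Local Notation lattice_of := (lattice_of ord pi).

Let V_neq0 : exists x : V, x != 0. Proof. by exists v. Qed.
Let p0 : pi != 0. Proof. exact: pi_neq0 hpi. Qed.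
Let pX k : pi ^ k != 0. Proof. exact: piX_neq0 hpi k. Qed.

Lemma homothety_class_dilate a L : a != 0 ->
  homothety_class (dilate a L) = homothety_class L.
Proof.
move=> a0; rewrite eqEsubset; split=> M.
  by move=> [b b0 ->]; exists (b * a); rewrite ?mulf_neq0 // dilate_dilate.
by move=> [b b0 ->]; exists (b / a); rewrite ?mulf_neq0 ?invr_neq0 // dilate_dilate divfK.
Qed.

Lemma homothety_class_refl L : homothety_class L L.
Proof. by exists 1; rewrite ?oner_neq0 // dilate1. Qed.

Lemma vertex_class t L : vertex t -> t L -> t = homothety_class L.
Proof. by move=> [M [_ [[_ ->] _ _ _ _]]] [a a0 ->]; rewrite homothety_class_dilate. Qed.

Lemma vertex_dilate t L a : vertex t -> a != 0 -> t L -> t (dilate a L).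
Proof. by move=> vt a0 tL; rewrite (vertex_class vt tL); exists a. Qed.

Lemma vertex_homothetic t L M : vertex t -> t L -> t M ->
  exists2 a, a != 0 & M = dilate a L.
Proof. by move=> vt tL; rewrite {1}(vertex_class vt tL). Qed.

Lemma special_lattice t : special t ->
  exists L s, [/\ t L, lattice L & modular s L].
Proof.
move=> [_ [u [w [a [b [buw tL [s ab]]]]]]]; exists (lattice_of u w a b), s.
split=> //; first exact: (lattice_of_lattice hpi buw).
exact: (lattice_of_modular hK hpi hBalt hV buw ab).
Qed.

Lemma special_modular t L : special t -> t L -> exists s, modular s L.
Proof.
move=> st tL; have [M [s [tM _ Ms]]] := special_lattice st.
have [a a0 ->] := vertex_homothetic st.1 tM tL.
by exists (s + 2%:Z * ord a); apply: modular_dilate.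
Qed.

(** M / pi L is a Lagrangian subspace of L / pi L for the form induced by
    pi^(-s) <,>. This describes an edge from either end, since (M, pi L) is
    again such a pair. *)
Definition modular_pair s L M :=
  [/\ modular s L, modular (s + 1) M, dilate pi L `<=` M & M `<=` L].

Lemma modular_pair_sym s L M :
  modular_pair s L M -> modular_pair (s + 1) M (dilate pi L).
Proof.
move=> [Ls Ms LM ML]; split=> //; last exact: dilateS.
by have := modular_dilate hK p0 Ls; rewrite hpi.2 mulr1; congr modular; lia.
Qed.

Lemma modular_pair_dilate a s L M : a != 0 -> modular_pair s L M ->
  modular_pair (s + 2%:Z * ord a) (dilate a L) (dilate a M).
Proof.
move=> a0 [Ls Ms LM ML]; split.
- exact: modular_dilate.
- by rewrite addrAC; apply: modular_dilate.
- by rewrite dilate_dilate mulrC -dilate_dilate; apply: dilateS.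
- exact: dilateS.
Qed.

Definition linked t t' :=
  exists L M s, [/\ t L, t' M & modular_pair s L M].

Lemma linked_sym t t' : vertex t -> linked t t' -> linked t' t.
Proof.
move=> vt [L [M [s [tL t'M LM]]]]; exists M, (dilate pi L), (s + 1).
by split=> //; [exact: vertex_dilate | exact: modular_pair_sym].
Qed.

(** Any representative of one end determines a representative of the other. *)
Lemma linked_at t t' L s : vertex t -> vertex t' -> linked t t' ->
  t L -> modular s L -> exists2 M, t' M & modular_pair s L M.
Proof.
move=> vt vt' [L1 [M1 [s1 [tL1 t'M1 LM1]]]] tL Ls.
have [a a0 LE] := vertex_homothetic vt tL1 tL.
have LM := modular_pair_dilate a0 LM1; rewrite -LE in LM.
exists (dilate a M1); first exact: vertex_dilate.
by have [Ls' _ _ _] := LM; rewrite (modular_inj hK hpi hBnd V_neq0 Ls Ls').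
Qed.

(** The totally isotropic subspace L / pi L0 of L0 / pi L0 has a modular
    preimage [L] only if it is zero or Lagrangian. *)
Lemma modular_between s L L0 :
  primitive ord pi n B L0 -> form_in B L (pi_ideal ord pi) -> modular s L ->
  dilate pi L0 `<=` L -> L `<=` L0 -> s = 1 \/ L = dilate pi L0.
Proof.
move=> prim form Ls piL0 LL0.
have L0s := primitive_modular hK hpi hV prim.
have s_gt0 : 0 < s.
  rewrite ltNge; apply/negP => s0; case/eqP: v0.
  apply: (modular_divisible_eq0 hK hpi hBnd Ls) => x Lx; apply/Ls.2 => y Ly.
  rewrite linearZl_LR -exprN1 (ord_ge_piX hK hpi).
  by have /(pi_idealE hK hpi) := form x y Lx Ly; apply: ord_ge_le; lia.
have [->|s1] := eqVneq s 1; [by left | right].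
rewrite eqEsubset; split=> // x Lx; apply/mem_dilate => //; apply/L0s.2 => y L0y.
(* s >= 2, so <x, pi y> is divisible by pi^2 and <x / pi, y> is integral. *)
have Ly : L (pi *: y) by apply: piL0; exists y.
have := modular_form Ls Lx Ly; rewrite linearZr_LR linearZl_LR -exprN1.
rewrite (ord_ge_piX hK hpi) -[pi in pi * _]/(pi ^ 1) (ord_ge_piX hK hpi).
by apply: ord_ge_le; lia.
Qed.

(** Of two distinct special vertices in a chain, neither two Lagrangians nor two
    copies of pi L0 can occur, so the smaller lattice is pi L0 and the larger
    one is Lagrangian. *)
Lemma linked_of_chain t t' L L' L0 : special t -> special t' -> t <> t' ->
  t L -> t' L' -> primitive ord pi n B L0 ->
  form_in B L (pi_ideal ord pi) -> form_in B L' (pi_ideal ord pi) ->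
  dilate pi L0 `<=` L -> L `<=` L' -> L' `<=` L0 -> linked t t'.
Proof.
move=> st st' tt' tL t'L' prim form form' piL0 LL' L'L0.
have neqL : L <> L'.
  by move=> LE; apply: tt'; rewrite (vertex_class st.1 tL) (vertex_class st'.1 t'L') LE.
have [s Ls] := special_modular st tL; have [s' Ls'] := special_modular st' t'L'.
have L0s := primitive_modular hK hpi hV prim.
have piL0s : modular 2 (dilate pi L0).
  by have := modular_dilate hK p0 L0s; rewrite hpi.2.
have LL0 : L `<=` L0 by move=> x /LL' /L'L0.
have piL0' : dilate pi L0 `<=` L' by move=> x /piL0 /LL'.
have [s'1|L'E] := modular_between prim form' Ls' piL0' L'L0; last first.
  by case: neqL; rewrite eqEsubset; split=> // x; rewrite L'E => /piL0.
have [s1|LE] := modular_between prim form Ls piL0 LL0.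
  by case: neqL; apply: (modular_sub_eq Ls) => //; rewrite s1 -s'1.
apply: linked_sym; [exact: st'.1 | exists L', L, 1].
split=> //; split=> //; first by rewrite -s'1.
  by rewrite LE.
by rewrite LE; apply: dilateS.
Qed.

Lemma adjacent_linked t t' : special t -> special t' -> adjacent t t' -> linked t t'.
Proof.
move=> st st' [_ vt' tt' [L [L' [L0 [[tL t'L'] prim form form' chain]]]]].
case: chain => -[h1 h2 h3]; first exact: (@linked_of_chain t t' L L' L0).
apply: linked_sym => //; apply: (@linked_of_chain t' t L' L L0) => //.
exact/nesym.
Qed.

Lemma adjacent_sym t t' : adjacent t t' -> adjacent t' t.
Proof.
move=> [vt vt' tt' [L [L' [L0 [[tL t'L'] prim form form' chain]]]]].
split=> //; first exact/nesym.
by exists L', L, L0; split=> //; case: chain; [right | left].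
Qed.

(** A relation instead of a function: the representative [L] is not canonical,
    but the value does not depend on it ([level_inj]). *)
Definition level t (j : int) := exists L s m,
  [/\ t L, modular s L, L (pi ^ m *: v), ~ L (pi ^ (m - 1) *: v)
    & j = 2%:Z * m - s].

(** Multiplying by [a] replaces (s, m) by (s + 2 ord a, m + ord a). *)
Lemma level_inj t i j : vertex t -> level t i -> level t j -> i = j.
Proof.
move=> vt [L [s [m [tL Ls Lm nLm ->]]]] [L' [s' [m' [tL' Ls' Lm' nLm' ->]]]].
have [a a0 LE] := vertex_homothetic vt tL tL'.
have ss' : s' = s + 2%:Z * ord a.
  apply: (modular_inj hK hpi hBnd V_neq0 Ls').
  by rewrite LE; apply: modular_dilate.
have memL' k : L' (pi ^ k *: v) <-> L (pi ^ (k - ord a) *: v).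
  rewrite LE (dilate_piX hK hpi Ls) // mem_dilate // scalerA invr_expz -expfzDr //.
  by rewrite addrC.
suff -> : m' = m + ord a by rewrite ss'; lia.
apply/le_anti/andP; split; rewrite leNgt; apply/negP => lt.
  apply: nLm'; apply/memL'; apply: (modular_piX hK hpi Ls _ Lm); lia.
apply: nLm; move/memL': Lm'; apply: (modular_piX hK hpi Ls); lia.
Qed.

Definition up t t' :=
  [/\ special t, special t', adjacent t t' & exists j, level t j /\ level t' (j + 1)].

Section Star.
Variables (t : set (set V)) (L : set V) (s m : int).
Hypotheses (st : special t) (tL : t L) (Ls : modular s L).
Hypotheses (Lm : L (pi ^ m *: v)) (nLm : ~ L (pi ^ (m - 1) *: v)).

Local Notation e := (pi ^ m *: v).

Lemma level_centre : level t (2%:Z * m - s).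
Proof. by exists L, s, m. Qed.

Lemma level_up t' M : t' M -> modular_pair s L M -> ~ M e ->
  level t' (2%:Z * m - s + 1).
Proof.
move=> t'M [_ Ms LM ML] nMe; exists M, (s + 1), (m + 1); split=> //.
- by apply: LM; apply/mem_dilate => //; rewrite scalerA -exprN1 -expfzDr // addrC addrK.
- by rewrite addrK.
- lia.
Qed.

Lemma up_of_notin t' M : special t' -> adjacent t t' -> t' M ->
  modular_pair s L M -> ~ M e -> up t t'.
Proof.
move=> st' tt' t'M LM nMe; split=> //; exists (2%:Z * m - s); split.
  exact: level_centre.
exact: level_up nMe.
Qed.

Lemma down_of_in t' M : special t' -> adjacent t' t -> t' M ->
  modular_pair s L M -> M e -> up t' t.
Proof.
move=> st' t't t'M [_ Ms LM ML] Me; split=> //; exists (2%:Z * m - (s + 1)); split.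
  by exists M, (s + 1), m; split=> // /ML.
have := level_centre; congr level; lia.
Qed.

(** A representative [M] that misses [e] would put [t'] one level above [t],
    whereas it lies one level below. *)
Lemma down_in t' : up t' t -> exists2 M, t' M & modular_pair s L M /\ M e.
Proof.
move=> [st' _ t't [j [lj lj1]]].
have tt' := linked_sym st'.1 (adjacent_linked st' st t't).
have [M t'M LM] := linked_at st.1 st'.1 tt' tL Ls.
exists M => //; split=> //; apply: contrapT => nMe.
have := level_inj st'.1 (level_up t'M LM nMe) lj.
have := level_inj st.1 level_centre lj1; lia.
Qed.

Lemma star_pair_unique t' M M' : vertex t' -> t' M -> t' M' ->
  modular_pair s L M -> modular_pair s L M' -> M = M'.
Proof.
move=> vt' t'M t'M' [_ Ms _ _] [_ Ms' _ _].
have [a a0 ME] := vertex_homothetic vt' t'M' t'M.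
exact: (modular_homothety_eq hK hpi hBnd V_neq0 a0 Ms' Ms).
Qed.

(** pi^-1 e is not in [L], so it does not pair [L] into pi^s; a vector that
    shows this pairs with [e] to a unit times pi^s. *)
Lemma dual_vector : exists2 f, L f & B e f = pi ^ s.
Proof.
have [f Lf nf] : exists2 f, L f & ~ ord_ge ord (s + 1) (B e f).
  apply: contrapT => h; apply: nLm; apply/Ls.2 => y Ly.
  have : ord_ge ord (s + 1) (B e y).
    by apply: contrapT => ny; apply: h; exists y.
  by rewrite !linearZl_LR !(ord_ge_piX hK hpi); apply: ord_ge_le; lia.
have := modular_form Ls Lm Lf; set z := B e f => zs.
have [z0|z0] := eqVneq z 0; first by case: nf; rewrite -/z z0; left.
have ez : ord z = s.
  case: zs => [/eqP|zs]; first by rewrite (negPf z0).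
  have /negP : ~ (s + 1 <= ord z) by move=> h; apply: nf; right.
  rewrite -ltNge; lia.
exists ((pi ^ s / z) *: f).
  apply: (modularZ hK Ls) => //; right.
  by rewrite (ord_mul hK) ?invr_neq0 // (ord_piX hK hpi) (ordV hK) // ez subrr.
by rewrite linearZr_LR -/z divfK.
Qed.

Section Fixing.
Variable g : {linear V -> V}.
Hypotheses (g_inj : injective g) (g_surj : forall y, exists x, g x = y).
Hypotheses (g_form : forall x y, B (g x) (g y) = B x y) (gL : g @` L = L).

Lemma fixing_centre : vertex_image g t = t.
Proof. by rewrite (vertex_class st.1 tL) image_homothety_class gL. Qed.

Lemma fixing_pair M : modular_pair s L M -> modular_pair s L (g @` M).
Proof.
move=> [_ Ms LM ML]; split=> //.
- exact: image_modular.
- by rewrite -[in dilate _ L]gL -image_dilate; apply: image_subset.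
- by rewrite -[X in _ `<=` X]gL; apply: image_subset.
Qed.

(** If the lattice of a lower neighbour contains [e], its image under [g] has
    exponent s + 1 and contains g e, so it cannot contain [e] as well. *)
Lemma fixing_up t' : ~ ord_ge ord (s + 1) (B (g e) e) ->
  up t' t -> up t (vertex_image g t').
Proof.
move=> nge ut; have [M t'M [LM Me]] := down_in ut; have [st' _ t't _] := ut.
apply: (@up_of_notin _ (g @` M)).
- exact: image_special_vertex.
- by rewrite -fixing_centre; apply/image_adjacent/adjacent_sym.
- by exists M.
- exact: fixing_pair.
- have [_ Ms _ _] := fixing_pair LM.
  by move=> gMe; apply: nge; apply: (modular_form Ms) => //; exists e.
Qed.

End Fixing.

Lemma transvection_fixes f : L f ->
  transvection B (pi ^ (- s)) f @` L = L.
Proof.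
move=> Lf.
have stable c : ord_ge ord (- s) c -> forall x, L x -> L (transvection B c f x).
  move=> cs x Lx; apply: (modularD hK Ls) => //; apply: (modularZ hK Ls) => //.
  by rewrite -[0](addNr s); apply: (ord_geM hK) => //; apply: (modular_form Ls).
have ps : ord_ge ord (- s) (pi ^ (- s)) by right; rewrite (ord_piX hK hpi).
rewrite eqEsubset; split=> [_ [x Lx <-]|x Lx]; first exact: stable.
exists (transvection B (- pi ^ (- s)) f x); first by apply: stable => //; apply: ord_geN.
by rewrite -{1}[pi ^ (- s)]opprK transvectionK.
Qed.


Lemma modular_pair_notin M x y : modular_pair s L M ->
  ~ ord_ge ord (s + 1) (B x y) -> M x -> ~ M y.
Proof. by move=> [_ Ms _ _] nge Mx My; apply/nge/(modular_form Ms). Qed.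

Lemma finite_special_neighbours :
  finite_set [set t' | special t' /\ (adjacent t t' \/ adjacent t' t)].
Proof.
have [L1 [s1 [tL1 latL1 L1s]]] := special_lattice st.
apply: (sub_finite_set _
  (finite_image (@homothety_class K V) (finite_intermediate hK hpi B latL1))).
move=> t' [st' tt'].
have {}tt' : adjacent t t' by case: tt' => // /adjacent_sym.
have [M t'M [_ Ms LM ML]] :=
  linked_at st.1 st'.1 (adjacent_linked st st' tt') tL1 L1s.
exists M; first by split=> //; exists (s1 + 1).
by rewrite (vertex_class st'.1 t'M).
Qed.

Lemma finite_up : finite_set [set t' | up t t'].
Proof.
apply: sub_finite_set finite_special_neighbours => t' [_ st' tt' _].
by split=> //; left.
Qed.

Lemma finite_down : finite_set [set t' | up t' t].
Proof.
apply: sub_finite_set finite_special_neighbours => t' [st' _ tt' _].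
by split=> //; right.
Qed.

(** For f dual to [e], the transvection along f sends e to e + f, and the
    transvection along e sends e + f to f; the second isometry is their
    composite. *)
Lemma two_fixing_isometries : exists g1 g2 : {linear V -> V},
  [/\ [/\ injective g1, forall y, exists x, g1 x = y,
         forall x y, B (g1 x) (g1 y) = B x y & g1 @` L = L],
      [/\ injective g2, forall y, exists x, g2 x = y,
         forall x y, B (g2 x) (g2 y) = B x y & g2 @` L = L],
      ~ ord_ge ord (s + 1) (B (g1 e) e), ~ ord_ge ord (s + 1) (B (g2 e) e)
    & ~ ord_ge ord (s + 1) (B (g1 e) (g2 e))].
Proof.
have [f Lf ef] := dual_vector.
have nge : ~ ord_ge ord (s + 1) (pi ^ s).
  by move=> [/eqP|]; rewrite ?(negPf (pX _)) // (ord_piX hK hpi); lia.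
have ngeN : ~ ord_ge ord (s + 1) (- pi ^ s).
  by move=> /(ord_geN hK); rewrite opprK.
have fe : B f e = - pi ^ s by rewrite (alternating_skew hBalt) ef.
pose c := pi ^ (- s); have cs : c * pi ^ s = 1 by rewrite -expfzDr // addNr.
pose h1 : {linear V -> V} := transvection B c f.
pose h2 : {linear V -> V} := transvection B c e.
have h1e : h1 e = e + f by rewrite /h1 /= /transvection ef cs scale1r.
have h2ef : h2 (e + f) = f.
  rewrite /h2 /= /transvection linearDl hBalt fe add0r mulrN cs scaleN1r.
  by rewrite addrAC subrr add0r.
exists h1, (h2 \o h1); split.
- split.
  + exact: (@transvection_inj _ _ _ hBalt c f).
  + exact: (@transvection_surj _ _ _ hBalt c f).
  + exact: (@transvection_form _ _ _ hBalt c f).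
  + exact: transvection_fixes.
- split.
  + apply: inj_comp; first exact: (@transvection_inj _ _ _ hBalt c e).
    exact: (@transvection_inj _ _ _ hBalt c f).
  + move=> y; have [z <-] := transvection_surj hBalt c e y.
    by have [x <-] := transvection_surj hBalt c f z; exists x.
  + by move=> x y /=; rewrite /h2 /h1 !(transvection_form hBalt).
  + by rewrite -[LHS]/((h2 \o h1) @` L) -image_comp !transvection_fixes.
- by rewrite h1e linearDl hBalt fe add0r.
- by rewrite /= h1e h2ef fe.
- by rewrite /= h1e h2ef linearDl ef hBalt addr0.
Qed.

(** The two isometries embed the lower neighbours twice, disjointly, in the
    upper ones. This is a strict inequality unless there are no lower
    neighbours, and then any neighbour is an upper one. *)
Lemma card_down_lt_up : (exists t', special t' /\ adjacent t t') ->
  (#|` fset_set [set t' | up t' t]| < #|` fset_set [set t' | up t t']|)%N.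
Proof.
move=> [t0 [st0 tt0]].
set D := fset_set _; set U := fset_set _.
have inD t' : t' \in D -> up t' t.
  by rewrite in_fset_set; [move/set_mem | exact: finite_down].
have inU t' : up t t' -> t' \in U.
  by move=> u; rewrite in_fset_set; [exact/mem_set | exact: finite_up].
have [g1 [g2 [[inj1 surj1 form1 fix1] [inj2 surj2 form2 fix2] n1 n2 n12]]] :=
  two_fixing_isometries.
pose I1 := [fset vertex_image g1 t' | t' in D]%fset.
pose I2 := [fset vertex_image g2 t' | t' in D]%fset.
have cardI1 : #|` I1| = #|` D| by apply/card_imfset/vertex_image_inj.
have cardI2 : #|` I2| = #|` D| by apply/card_imfset/vertex_image_inj.
have subU : (I1 `|` I2 `<=` U)%fset.
  apply/fsubsetP => t'; rewrite in_fsetU => /orP[] /imfsetP[t1 /= /inD ut ->];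
    by apply/inU/fixing_up.
have disj : (I1 `&` I2 = fset0)%fset.
  apply/eqP/fset0Pn => -[t']; rewrite in_fsetI => /andP[].
  move=> /imfsetP[t1 /= /inD u1 ->] /imfsetP[t2 /= /inD u2 e12].
  have [M1 t1M1 [LM1 M1e]] := down_in u1; have [M2 t2M2 [LM2 M2e]] := down_in u2.
  have LgM1 := fixing_pair inj1 surj1 form1 fix1 LM1.
  have LgM2 := fixing_pair inj2 surj2 form2 fix2 LM2.
  have [st1 _ _ _] := u1.
  have gM12 : g1 @` M1 = g2 @` M2.
    apply: (@star_pair_unique (vertex_image g1 t1)) => //.
    - by apply: image_building_vertex => //; case: st1.
    - by exists M1.
    - by rewrite e12; exists M2.
  apply: (modular_pair_notin LgM1 n12); first exact: imageP.
  by rewrite gM12; apply: imageP.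
have [D0|Dpos] := posnP #|` D|; last first.
  have := fsubset_leq_card subU; rewrite cardfsU disj cardfs0 subn0 cardI1 cardI2.
  by apply: leq_trans; rewrite -addn1 leq_add2l.
rewrite D0 cardfs_gt0; apply/fset0Pn; exists t0; apply: inU.
have [M t0M LM] := linked_at st.1 st0.1 (adjacent_linked st st0 tt0) tL Ls.
apply: (up_of_notin st0 tt0 t0M LM) => Me.
have ut : up t0 t by apply: (down_of_in st0 (adjacent_sym tt0) t0M LM Me).
suff : t0 \in D by rewrite (cardfs0_eq D0).
by rewrite in_fset_set; [exact/mem_set | exact: finite_down].
Qed.

End Star.
(** * Existence of special vertices and of their neighbours *)

Section StandardEdge.
Variables (u w : n.-tuple V) (a b : 'I_n -> int).
Hypotheses (buw : symplectic_basis B u w) (ab : forall i, a i + b i = 0).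

Local Notation L0 := (lattice_of u w a b).
Local Notation L1 := (lattice_of u w a (fun i => b i + 1)).

Let piL0E : dilate pi L0 = lattice_of u w (fun i => a i + 1) (fun i => b i + 1).
Proof. exact: (dilate_lattice_of hK hpi buw a b 1). Qed.

Let piL0_L1 : dilate pi L0 `<=` L1.
Proof. by rewrite piL0E; apply: (lattice_ofS hK hpi buw) => i //; lia. Qed.

Let L1_L0 : L1 `<=` L0.
Proof. by apply: (lattice_ofS hK hpi buw) => i //; lia. Qed.

Let L0_modular : modular 0 L0.
Proof. exact: (lattice_of_modular hK hpi hBalt hV buw). Qed.

Let L1_modular : modular 1 L1.
Proof.
by apply: (lattice_of_modular hK hpi hBalt hV buw) => i; have := ab i; lia.
Qed.

Let L0_primitive : primitive ord pi n B L0.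
Proof. exact: (lattice_of_primitive hK hpi hBalt hV buw). Qed.

Let piL0_form : form_in B (dilate pi L0) (pi_ideal ord pi).
Proof.
have pis := modular_dilate hK p0 L0_modular.
move=> x y Lx Ly; apply/(pi_idealE hK hpi).
by apply: ord_ge_le (modular_form pis Lx Ly); rewrite hpi.2.
Qed.

Let L1_form : form_in B L1 (pi_ideal ord pi).
Proof.
by move=> x y Lx Ly; apply/(pi_idealE hK hpi)/(modular_form L1_modular).
Qed.

Lemma standard_special0 : special (homothety_class L0).
Proof.
split.
  exists (dilate pi L0), L0; split=> //; last by move=> x /piL0_L1 /L1_L0.
  split; first by rewrite piL0E; apply: (lattice_of_lattice hpi buw).
  by rewrite homothety_class_dilate.
exists u, w, a, b; split=> //; first exact: homothety_class_refl.
by exists 0.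
Qed.

Lemma standard_special1 : special (homothety_class L1).
Proof.
split.
  exists L1, L0; split=> //.
  by split=> //; apply: (lattice_of_lattice hpi buw).
exists u, w, a, (fun i => b i + 1); split=> //; first exact: homothety_class_refl.
by exists 1 => i; have := ab i; lia.
Qed.

Lemma standard_adjacent : adjacent (homothety_class L0) (homothety_class L1).
Proof.
split; [exact: standard_special0.1 | exact: standard_special1.1 | |].
  move=> e01; have : homothety_class L0 L1.
    by rewrite e01; apply: homothety_class_refl.
  move=> [c c0 L1E]; have := modular_dilate hK c0 L0_modular.
  rewrite -L1E => /(modular_inj hK hpi hBnd V_neq0 L1_modular); lia.
exists (dilate pi L0), L1, L0; split=> //; last by left; split.
split; last exact: homothety_class_refl.
exact: vertex_dilate standard_special0.1 p0 (homothety_class_refl _).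
Qed.

End StandardEdge.

(** After dividing by pi^r, with s = 2r + e and e in {0, 1}, the vertex is one
    of the two ends of a standard edge. *)
Lemma special_has_neighbour t : special t -> exists t', special t' /\ adjacent t t'.
Proof.
move=> [vt [u [w [a [b [buw tL [s ab]]]]]]].
pose r := (s %/ 2)%Z; pose e := (s %% 2)%Z.
pose a' i := a i - r; pose b' i := b i - r - e.
have ab' i : a' i + b' i = 0 by rewrite /a' /b'; have := ab i; lia.
have tE : t = homothety_class (lattice_of u w a' (fun i => b' i + e)).
  apply: (vertex_class vt); have := vertex_dilate vt (pX (- r)) tL.
  rewrite (dilate_lattice_of hK hpi buw); congr (t (lattice_of u w _ _)).
  by apply/funext => i; rewrite /b'; lia.
have [e0|e1] : e = 0 \/ e = 1 by rewrite /e; lia.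
  exists (homothety_class (lattice_of u w a' (fun i => b' i + 1))).
  have -> : t = homothety_class (lattice_of u w a' b').
    rewrite tE e0; congr (homothety_class (lattice_of u w a' _)).
    by apply/funext => i; rewrite addr0.
  by split; [exact: standard_special1 | exact: standard_adjacent].
exists (homothety_class (lattice_of u w a' b')).
rewrite tE e1; split; first exact: standard_special0.
exact/adjacent_sym/standard_adjacent.
Qed.

Lemma special_vertex_exists : exists t, special t.
Proof.
have [u [w buw]] := symplectic_basis_exists hBalt hBnd hV.
by eexists; apply: (standard_special0 (a := fun=> 0) (b := fun=> 0) buw).
Qed.

Lemma card_leq_special_boundary (A : set (set (set V))) :
  A `<=` vertices (special_graph ord pi n B) -> finite_set A ->
  (#|` fset_set A| <=
   #|` fset_set (edge_boundary (special_graph ord pi n B) A)|)%N.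
Proof.
apply: (leq_card_edge_boundary (up := up)).
- by move=> t t' [].
- by move=> t; apply: finite_special_neighbours.
- move=> t st; have [L [s [tL _ Ls]]] := special_lattice st.
  have [m [Lm nLm]] := modular_minimal_multiple hK hpi hBnd Ls v0.
  exact: (card_down_lt_up st tL Ls Lm nLm (special_has_neighbour st)).
Qed.

End SpecialGraph.

Theorem theorem2p7 (R : realType) (n : nat) (hn : (2 <= n)%N)
    (K : fieldType) (ord : K -> int) (hK : local_field ord)
    (pi : K) (hpi : uniformizer ord pi)
    (V : vectType K) (hV : \dim {:V} = (2 * n)%N)
    (B : {biscalar V}) (hBalt : alternating_form B)
    (hBnd : nondegenerate_form B) :
  0 < isoperimetric_constant R (special_graph ord pi n B).
Proof.
have v0 : vpick {:V} != 0 by rewrite vpick0 -dimv_eq0 hV; lia.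
apply: (@lt_le_trans _ _ 1) => //; apply: lb_le_inf.
  have [t st] := special_vertex_exists hK hpi hV hBalt hBnd v0.
  eexists; exists [set t]; split=> //; [by move=> _ -> | by exists t].
move=> _ [A [sA finA A0 ->]].
have Apos : (0 < #|` fset_set A|)%N.
  have [t At] := A0; rewrite cardfs_gt0; apply/fset0Pn; exists t.
  by rewrite in_fset_set //; apply/mem_set.
rewrite ler_pdivlMr ?ltr0n // mul1r ler_nat.
exact: (card_leq_special_boundary hK hpi hV hBalt hBnd v0 sA finA).
Qed.
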